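(* Let $G$ be an undirected weighted graph, $s,t$ vertices such that $\pi_G(s,t)$ has $2^k$ edges, and let $H$, $m_{i,j}$, $H_{i,0}$, $H_{i,1}$ be as defined below. Let $d_1=(s\oplus(l-1),s\oplus l)$ and $d_2=(s\oplus r,s\oplus(r+1))$ with $0<l\le r<2^k$, let $i\ge 1$ be the smallest level for which there is an index $j$ with $d_1$ in $Q_{i,j-1}$ and $d_2$ in $Q_{i,j}$, and let $j$ be that index. Let $d_3$ be an edge of $G$ not on $\pi_G(s,t)$. Then $|\pi_{G-\{d_1,d_2,d_3\}}(s,t)|$ equals the minimum of the following four values: (1) $|\pi_{H-\{d_3\}}(d_1^-,d_2^+)|-2N$; (2) $|\pi_{H_{i,0}-\{d_1,d_3\}}(d_1^-,d_2^+)|-2N$; (3) $|\pi_{H_{i,1}-\{d_2,d_3\}}(d_1^-,d_2^+)|-2N$; (4) $\min\{|\pi_{H_{i,0}-\{d_1,d_3\}}(d_1^-,m_{i,j})|,|\pi_{H_{i,1}-\{d_2,d_3\}}(d_1^-,m_{i,j})|\}+\min\{|\pi_{H_{i,0}-\{d_1,d_3\}}(m_{i,j},d_2^+)|,|\pi_{H_{i,1}-\{d_2,d_3\}}(m_{i,j},d_2^+)|\}-2N$.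
   Context: $\pi_{G'}(u,v)$ is the shortest $u$-$v$ path in graph $G'$, $|P|$ its length (infinite if none), $G'-F$ removes edges of $F$. The vertices of $\pi_G(s,t)$ are $s\oplus 0=s, s\oplus1,\dots,s\oplus 2^k=t$ in order; for vertices $a,b$ on it, $ab$ is the subpath between them. $N$ is the sum of all edge weights of $G$. $H$ is obtained from $G$ by removing all edges of $\pi_G(s,t)$ and, for every edge $d=(x,y)$ on $\pi_G(s,t)$ with $x$ closer to $s$, adding new vertices $d^-,d^+$, joining $d^-$ to every vertex $x'$ of $sx$ by an edge of weight $|sx'|+N$ and $d^+$ to every vertex $y'$ of $yt$ by an edge of weight $|y't|+N$. Define $m_{0,0}=s$, $m_{0,1}=t$, and for $1\le i\le k$, $0\le j\le 2^i$: $m_{i,j}=m_{i-1,j/2}$ if $j$ is even, and $m_{i,j}=m_{i-1,(j-1)/2}\oplus 2^{k-i}$ if $j$ is odd. $Q_{i,j}$ ($0\le j<2^i$) is the subpath of $\pi_G(s,t)$ from $m_{i,j}$ to $m_{i,j+1}$. $H_{i,0}$ is $H$ together with the edges of all $Q_{i,j}$ with $j$ even, and $H_{i,1}$ is $H$ together with the edges of all $Q_{i,j}$ with $j$ odd.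
   Formalization: Edge weights are taken nonnegative and t is assumed reachable from s in G-{d_1,d_2,d_3}; if it is not, the distance is infinite while value (1) is finite via d_1^-, s, d_2^-, s⊕l, d_1^+, t, d_2^+, so the equality fails. *)

(* Defs.v *)
From HB Require Import structures.
From mathcomp Require Import all_boot all_order all_algebra.
From mathcomp Require Import constructive_ereal.

Set Implicit Arguments.
Unset Strict Implicit.
Unset Printing Implicit Defensive.

Import Order.TTheory GRing.Theory Num.Theory.
Local Open Scope ring_scope.

(* Values of [wt] outside [adj] are never used. *)
Record wgraph (R : realDomainType) (V : finType) := WGraph {
  adj : rel V;
  wt : V -> V -> R;
  adj_sym : symmetric adj;
  adj_irr : irreflexive adj;
  wt_sym : forall x y, wt x y = wt y x
}.

Definition nonneg_weights (R : realDomainType) (V : finType)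
    (G : wgraph R V) : Prop :=
  forall x y, adj G x y -> 0 <= wt G x y.

(* The index order counts every undirected edge exactly once. *)
Definition total_weight (R : realDomainType) (V : finType)
    (G : wgraph R V) : R :=
  \sum_(x : V) \sum_(y : V | adj G x y && (enum_rank x < enum_rank y)%N)
     wt G x y.

(* As in [path], a path is given by its first vertex [u] and the sequence [p]
   of the following ones. *)
Definition plen (R : realDomainType) (V : finType) (G : wgraph R V)
    (u : V) (p : seq V) : R :=
  \sum_(e <- zip (u :: p) p) wt G e.1 e.2.

Definition simple_path (R : realDomainType) (V : finType) (G : wgraph R V)
    (u v : V) (p : seq V) : bool :=
  [&& path (adj G) u p, last u p == v & uniq (u :: p)].

(* A simple path has fewer than #|V| edges, so the minimum ranges over all
   simple u-v paths; it is +oo if there are none. *)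
Definition dist (R : realDomainType) (V : finType) (G : wgraph R V)
    (u v : V) : \bar R :=
  \big[Order.min/+oo%E]_(p : #|V|.-bseq V | simple_path G u v p)
     (plen G u p)%:E.

Definition shortest_path (R : realDomainType) (V : finType) (G : wgraph R V)
    (u v : V) (p : seq V) : Prop :=
  simple_path G u v p /\ (plen G u p)%:E = dist G u v.


Lemma del_sym (R : realDomainType) (V : finType) (G : wgraph R V)
    (F : {set {set V}}) :
  symmetric (fun x y => adj G x y && ([set x; y] \notin F)).
Proof. by move=> x y /=; rewrite adj_sym setUC. Qed.

Lemma del_irr (R : realDomainType) (V : finType) (G : wgraph R V)
    (F : {set {set V}}) :
  irreflexive (fun x y => adj G x y && ([set x; y] \notin F)).
Proof. by move=> x /=; rewrite adj_irr. Qed.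

Definition del (R : realDomainType) (V : finType) (G : wgraph R V)
    (F : {set {set V}}) : wgraph R V :=
  WGraph (del_sym G F) (del_irr G F) (wt_sym G).

(* From here on the path pi_G(s,t) is [s :: p]. *)

Definition vtx (V : finType) (s : V) (p : seq V) (n : nat) : V :=
  nth s (s :: p) n.

Definition pedge (V : finType) (s : V) (p : seq V) (n : nat) : {set V} :=
  [set vtx s p n; vtx s p n.+1].

Definition pedges (V : finType) (s : V) (p : seq V) : {set {set V}} :=
  [set pedge s p n | n : 'I_(size p)].

(* m_{i,j} is the vertex at position [mpos k i j] of the path. *)
Fixpoint mpos (k i j : nat) : nat :=
  match i with
  | 0 => if j is 0 then 0%N else (2 ^ k)%N
  | i'.+1 => if odd j then (mpos k i' (j.-1)./2 + 2 ^ (k - i))%N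
             else mpos k i' j./2
  end.

Definition mvtx (V : finType) (s : V) (p : seq V) (k i j : nat) : V :=
  vtx s p (mpos k i j).

Definition Qedges (V : finType) (s : V) (p : seq V) (k i j : nat) :
    {set {set V}} :=
  [set pedge s p n | n : 'I_(size p) & (mpos k i j <= n < mpos k i j.+1)%N].

(* New vertices: [inl d] is d^- and [inr d] is d^+, where d is the edge
   [pedge s p d]; then sx is [take d.+1 (s :: p)] and yt is
   [drop d.+1 (s :: p)]. *)
Definition aux_adj (V : finType) (s : V) (p : seq V)
    (c : 'I_(size p) + 'I_(size p)) (x : V) : bool :=
  match c with
  | inl d => x \in take d.+1 (s :: p)
  | inr d => x \in drop d.+1 (s :: p)
  end.

Definition aux_wt (R : realDomainType) (V : finType) (G : wgraph R V)
    (s : V) (p : seq V) (c : 'I_(size p) + 'I_(size p)) (x : V) : R :=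
  match c with
  | inl _ => plen G s (take (index x (s :: p)) p) + total_weight G
  | inr _ => plen G x (drop (index x (s :: p)) p) + total_weight G
  end.

Definition dminus (V : finType) (p : seq V) (d : 'I_(size p)) :
  V + ('I_(size p) + 'I_(size p)) := inr (inl d).

Definition dplus (V : finType) (p : seq V) (d : 'I_(size p)) :
  V + ('I_(size p) + 'I_(size p)) := inr (inr d).

Definition old (V : finType) (p : seq V) (x : V) :
  V + ('I_(size p) + 'I_(size p)) := inl x.

Definition old_edge (V : finType) (p : seq V) (e : {set V}) :
  {set V + ('I_(size p) + 'I_(size p))} := [set old p x | x in e].

Definition H_adj (R : realDomainType) (V : finType) (G : wgraph R V)
    (s : V) (p : seq V) (K : {set {set V}})
    (u v : V + ('I_(size p) + 'I_(size p))) : bool :=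
  match u, v with
  | inl x, inl y => adj (del G (pedges s p :\: K)) x y
  | inr c, inl x | inl x, inr c => aux_adj s c x
  | inr _, inr _ => false
  end.

Definition H_wt (R : realDomainType) (V : finType) (G : wgraph R V)
    (s : V) (p : seq V) (u v : V + ('I_(size p) + 'I_(size p))) : R :=
  match u, v with
  | inl x, inl y => wt G x y
  | inr c, inl x | inl x, inr c => aux_wt G s c x
  | inr _, inr _ => 0
  end.

Lemma H_adj_sym (R : realDomainType) (V : finType) (G : wgraph R V)
    (s : V) (p : seq V) (K : {set {set V}}) :
  symmetric (@H_adj R V G s p K).
Proof. by case=> [x|c] [y|c'] //; apply: (adj_sym (del G _)). Qed.

Lemma H_adj_irr (R : realDomainType) (V : finType) (G : wgraph R V)
    (s : V) (p : seq V) (K : {set {set V}}) :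
  irreflexive (@H_adj R V G s p K).
Proof. by case=> [x|c] //; apply: (adj_irr (del G _)). Qed.

Lemma H_wt_sym (R : realDomainType) (V : finType) (G : wgraph R V)
    (s : V) (p : seq V) (u v : V + ('I_(size p) + 'I_(size p))) :
  H_wt G s u v = H_wt G s v u.
Proof. by case: u v => [x|c] [y|c'] //; apply: wt_sym. Qed.

(* H together with the edges of the path that belong to [K].  All the new
   vertices live in one graph, so walks through further new vertices exist even
   when s and t get disconnected in G; such walks use at least four edges of
   weight at least [total_weight G]. *)
Definition Hplus (R : realDomainType) (V : finType) (G : wgraph R V)
    (s : V) (p : seq V) (K : {set {set V}}) :
    wgraph R (V + ('I_(size p) + 'I_(size p)))%type :=
  WGraph (@H_adj_sym R V G s p K) (@H_adj_irr R V G s p K)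
         (@H_wt_sym R V G s p).

Definition Hgraph (R : realDomainType) (V : finType) (G : wgraph R V)
    (s : V) (p : seq V) := Hplus G s p set0.

(* [b = false] is H_{i,0} and [b = true] is H_{i,1}. *)
Definition Hlevel (R : realDomainType) (V : finType) (G : wgraph R V)
    (s : V) (p : seq V) (k i : nat) (b : bool) :=
  Hplus G s p (\bigcup_(j < 2 ^ i | odd j == b) Qedges s p k i j).

Definition separated_at (V : finType) (s : V) (p : seq V) (k : nat)
    (d1 d2 : {set V}) (i j : nat) : bool :=
  [&& (0 < j < 2 ^ i)%N, d1 \in Qedges s p k i j.-1
    & d2 \in Qedges s p k i j].

(* Main.v *)
(* Write P = pi_G(s,t). Removing d1 and d2 splits P into a prefix A, a
   middle part B containing m = m_{i,j}, and a suffix C. Given a walk from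
   s to t that avoids d1, d2, d3, let x be its last vertex in A and y the
   first vertex in C after x; since P is a shortest path, the portions
   before x and after y may be replaced by subpaths of P, which are
   encoded by the edges at d1^- and d2^+. If the walk between x and y
   misses B, this gives value (1). Otherwise let w and w' be the first and
   last vertices of B on it; the portion from w to w' may be replaced by
   the subpath ww' of P, and outside of it no edge of P is used. If w and
   w' lie on the same side of m, we get value (2) or (3), and otherwise
   ww' passes through m, which gives value (4).
   Conversely, minimality of i makes j odd, so that d2 is not in H_{i,0}
   and d1 is not in H_{i,1}, and a walk in the auxiliary graphs that does
   not pass through further new vertices is a walk in G - {d1,d2,d3}. A
   walk that does uses at least four (three, when one of its ends is m)
   edges of weight at least N, so the corresponding value is at least 2N,
   whereas a finite distance in G - {d1,d2,d3} is at most N. *)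
Require Import Defs.
From mathcomp Require Import all_boot all_order all_algebra.
From mathcomp Require Import constructive_ereal.
From mathcomp Require Import zify ring lra.

Set Implicit Arguments.
Unset Strict Implicit.
Unset Printing Implicit Defensive.

Import Order.TTheory GRing.Theory Num.Theory.
Local Open Scope ring_scope.

Definition walk (R : realDomainType) (V : finType) (G : wgraph R V)
    (u v : V) (c : R) : Prop :=
  exists2 q, path (adj G) u q /\ last u q = v & plen G u q = c.

(** * Walks and distances *)

Section Walks.
Context {R : realDomainType} {V : finType}.
Implicit Types (G : wgraph R V) (u v x y : V) (q : seq V) (c : R).

Lemma plen_nil G u : plen G u [::] = 0.
Proof. by rewrite /plen big_nil. Qed.

Lemma plen_cons G u v q : plen G u (v :: q) = wt G u v + plen G v q.
Proof. by rewrite /plen /= big_cons. Qed.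

Lemma plen_cat G u q1 q2 :
  plen G u (q1 ++ q2) = plen G u q1 + plen G (last u q1) q2.
Proof.
elim: q1 u => [|x q1 IH] u /=; first by rewrite plen_nil add0r.
by rewrite !plen_cons IH addrA.
Qed.

Lemma plen_ge0 G u q : nonneg_weights G -> path (adj G) u q -> 0 <= plen G u q.
Proof.
move=> G0; elim: q u => [|x q IH] u /=; first by rewrite plen_nil.
by case/andP=> /G0 ux /IH; rewrite plen_cons; apply: addr_ge0.
Qed.

Lemma nonneg_del G (F : {set {set V}}) :
  nonneg_weights G -> nonneg_weights (del G F).
Proof. by move=> G0 x y /andP[/G0]. Qed.

Lemma walk_refl G u : walk G u u 0.
Proof. by exists [::]; rewrite ?plen_nil. Qed.

Lemma walk_edge G u v : adj G u v -> walk G u v (wt G u v).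
Proof.
by move=> uv; exists [:: v]; rewrite ?plen_cons ?plen_nil ?addr0 //= uv.
Qed.

Lemma walk_cat G u v x c1 c2 :
  walk G u v c1 -> walk G v x c2 -> walk G u x (c1 + c2).
Proof.
move=> [q1 [p1 l1] <-] [q2 [p2 l2] <-]; exists (q1 ++ q2).
  by rewrite cat_path last_cat l1 p1 p2 l2.
by rewrite plen_cat l1.
Qed.

Lemma walk_sym G u v c : walk G u v c -> walk G v u c.
Proof.
case=> q [+ +] <-; elim: q u => [|x q IH] u /=.
  by move=> _ <-; rewrite plen_nil; apply: walk_refl.
case/andP=> ux xq xv; rewrite plen_cons addrC; apply: walk_cat (IH _ xq xv) _.
by rewrite wt_sym; apply: walk_edge; rewrite adj_sym.
Qed.

Lemma walk_ge0 G u v c : nonneg_weights G -> walk G u v c -> 0 <= c.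
Proof. by move=> G0 [q [pq _] <-]; apply: plen_ge0. Qed.

Lemma sub_walk (G G' : wgraph R V) u v c :
    subrel (adj G) (adj G') -> wt G =2 wt G' ->
  walk G u v c -> walk G' u v c.
Proof.
move=> sub eqw [q [pq lq] <-]; exists q; first by rewrite (sub_path sub pq).
by apply: eq_bigr => e _; rewrite eqw.
Qed.

(** Induction along the walk: when the new first vertex already lies on the simple path built for
    the tail, the cycle up to that occurrence is cut out, which does not increase the length as
    weights are nonnegative. *)
Lemma walk_simple G u v c : nonneg_weights G -> walk G u v c ->
  exists2 q, simple_path G u v q & plen G u q <= c.
Proof.
move=> G0 [q [+ +] <-]; elim: q u => [|x q IH] u /=.
  by move=> _ uv; exists [::]; rewrite // /simple_path /= uv eqxx.
case/andP=> ux xq xv; have [q' /and3P[pq' /eqP lq' uq'] le_q'] := IH _ xq xv.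
have [uin|unin] := boolP (u \in x :: q'); last first.
  exists (x :: q'); first by rewrite /simple_path /= ux pq' lq' eqxx unin.
  by rewrite !plen_cons lerD2l.
have w0 := G0 _ _ ux.
move: uin; rewrite inE => /predU1P[eq_ux|].
  exists q'; first by rewrite /simple_path eq_ux pq' lq' eqxx.
  by rewrite plen_cons; apply: (le_trans (y := plen G x q));
    [rewrite eq_ux|rewrite lerDr].
move=> /path.splitPr uq; case: uq pq' lq' uq' le_q' => q1 q2.
rewrite cat_path /= last_cat /= cat_uniq plen_cat plen_cons.
case/and3P=> p1 e1 p2 l2 /and4P[_ _ _ u2] le_q'.
exists q2; first by rewrite /simple_path p2 l2 eqxx.
have := plen_ge0 G0 p1; have := G0 _ _ e1.
by rewrite plen_cons; lra.
Qed.

Lemma dist_le G u v c : nonneg_weights G -> walk G u v c ->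
  (dist G u v <= c%:E)%E.
Proof.
move=> G0 /(walk_simple G0)[q sq le_qc].
have szq : (size q <= #|V|)%N.
  case/and3P: sq => _ _ /card_uniqP/= sz.
  by apply: leq_trans (max_card (mem (u :: q))); rewrite sz.
apply: (@le_trans _ _ (plen G u q)%:E); last by rewrite lee_fin.
by rewrite /dist; exact: (@bigmin_le_cond _ _ _ _ (Bseq szq)).
Qed.

Variant dist_spec G u v : \bar R -> Prop :=
  | DistInf : dist_spec G u v +oo%E
  | DistFin q of simple_path G u v q : dist_spec G u v (plen G u q)%:E.

Lemma distP G u v : dist_spec G u v (dist G u v).
Proof.
rewrite /dist; apply: big_ind => [|x y hx hy|q sq]; first exact: DistInf.
  by rewrite minEle; case: ifP.
exact: DistFin.
Qed.

Lemma le_dist G u v (z : \bar R) :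
  (forall c, walk G u v c -> (z <= c%:E)%E) -> (z <= dist G u v)%E.
Proof.
case: distP => [|q /and3P[pq /eqP lq _]] H; first exact: leey.
by apply: H; exists q.
Qed.

(** Oriented by increasing [enum_rank], the edges of a simple path become distinct terms of the sum
    [total_weight], and the remaining terms are nonnegative. *)
Lemma simple_path_le_total G u v q : nonneg_weights G ->
  simple_path G u v q -> plen G u q <= total_weight G.
Proof.
move=> G0 /and3P[pq _ uq].
pose orient (e : V * V) := if (enum_rank e.1 < enum_rank e.2)%N then e
  else (e.2, e.1).
have wE e : wt G (orient e).1 (orient e).2 = wt G e.1 e.2.
  by rewrite /orient; case: ifP => //= _; rewrite wt_sym.
pose es := [seq orient e | e <- zip (u :: q) q].
have memE x r e : e \in zip (x :: r) r -> e.1 \in x :: r /\ e.2 \in r.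
  elim: r x => //= y r IH x; rewrite inE => /predU1P[->|/IH[]].
    by rewrite !inE !eqxx.
  by rewrite !inE => /orP[] -> ->; rewrite !orbT.
(* A repeated edge would make the first vertex [x] reappear later on the path. *)
have ues : uniq es.
  rewrite /es; elim: q u {pq es} uq => //= y r IH x /andP[xN /IH ->].
  rewrite andbT; apply/mapP => -[[e1 e2] /memE[/= h1 h2]].
  move: xN; have : e2 \in y :: r by rewrite inE h2 orbT.
  move: h1 => /[swap] h2' h1 /negP xN; rewrite /orient /=.
  by case: ifP => _; case: ifP => _ [E1 E2]; apply: xN; subst.
have aes e : e \in es -> adj G e.1 e.2 && (enum_rank e.1 < enum_rank e.2)%N.
  case/mapP=> -[e1 e2] he ->.
  have ae : adj G e1 e2.
    elim: q u {uq es ues} pq he => //= y r IH x /andP[xy /IH].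
    by move=> H; rewrite inE => /predU1P[[-> ->]|/H].
  rewrite /orient /=; case: ltnP => /=; rewrite ?ae //.
  rewrite adj_sym ae ltn_neqAle => ->; rewrite andbT.
  apply: contraTneq ae => /val_inj/enum_rank_inj ->.
  by rewrite adj_irr.
have -> : plen G u q = \sum_(e <- es) wt G e.1 e.2.
  by rewrite /es big_map; apply: eq_bigr => e _; rewrite wE.
rewrite /total_weight pair_big_dep /= big_uniq //=.
rewrite [leRHS](bigID (mem es)) /=.
rewrite [X in _ <= X + _](eq_bigl (mem es)) => [|e]; last first.
  by rewrite andb_idl // => /aes.
rewrite lerDl; apply: sumr_ge0 => e /andP[/andP[/G0 //]].
Qed.

End Walks.

Lemma path_cons (T : Type) (e : rel T) x y q :
  path e x (y :: q) = e x y && path e y q.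
Proof. by []. Qed.

(** * The shortest path and the auxiliary graphs *)

Section PathPositions.
Context {R : realDomainType} {V : finType} (G : wgraph R V) (s t : V)
  (p : seq V).
Hypothesis G_ge0 : nonneg_weights G.
Hypothesis p_shortest : shortest_path G s t p.

(** Prefix lengths of the path: the subpath between positions [a <= b] has length
    [pos b - pos a]. *)
Definition pos (n : nat) : R := plen G s (take n p).

Lemma vtx_inj n m : (n <= size p)%N -> (m <= size p)%N ->
  vtx s p n = vtx s p m -> n = m.
Proof.
have [/and3P[_ _ u] _] := p_shortest.
by move=> hn hm /eqP; rewrite /vtx nth_uniq // => /eqP.
Qed.

Lemma vtx_last : vtx s p (size p) = t.
Proof.
have [/and3P[_ /eqP <- _] _] := p_shortest.
by rewrite (last_nth s).
Qed.

Lemma vtx_adj n : (n < size p)%N -> adj G (vtx s p n) (vtx s p n.+1).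
Proof. by have [/and3P[/(pathP s) H _ _] _] := p_shortest; apply: H. Qed.

Lemma last_take_vtx n : (n <= size p)%N -> last s (take n p) = vtx s p n.
Proof.
move=> hn; rewrite (last_nth s) size_takel //.
by rewrite /vtx; case: n hn => //= n hn; rewrite nth_take.
Qed.

Lemma pos0 : pos 0 = 0.
Proof. by rewrite /pos take0 plen_nil. Qed.

Lemma posS n : (n < size p)%N ->
  pos n.+1 = pos n + wt G (vtx s p n) (vtx s p n.+1).
Proof.
move=> hn; rewrite /pos (take_nth s) // -cats1 plen_cat plen_cons plen_nil.
by rewrite addr0 last_take_vtx 1?ltnW.
Qed.

Lemma index_vtx n : (n <= size p)%N -> index (vtx s p n) (s :: p) = n.
Proof.
have [/and3P[_ _ u] _] := p_shortest.
by move=> hn; rewrite /vtx index_uniq.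
Qed.

Lemma pathwalk (F : {set {set V}}) a b : (a <= b <= size p)%N ->
    (forall n, (a <= n < b)%N -> pedge s p n \notin F) ->
  walk (del G F) (vtx s p a) (vtx s p b) (pos b - pos a).
Proof.
elim: b => [|b IH] /andP[ab bp] HF.
  by move: ab; rewrite leqn0 => /eqP ->; rewrite subrr; apply: walk_refl.
move: ab; rewrite leq_eqVlt => /predU1P[->|ab].
  by rewrite subrr; apply: walk_refl.
rewrite posS // addrAC; apply: walk_cat.
  apply: IH => [|n /andP[an nb]]; first by rewrite -ltnS ab ltnW.
  by apply: HF; rewrite an ltnW.
apply: (@walk_edge _ _ (del G F)); rewrite /= vtx_adj //=.
by apply: HF; rewrite -ltnS ab leqnn.
Qed.

Lemma pedge_inj n m : (n < size p)%N -> (m < size p)%N ->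
  pedge s p n = pedge s p m -> n = m.
Proof.
move=> hn hm /setP E; have := E (vtx s p n); have := E (vtx s p n.+1).
rewrite !inE !eqxx orbT /=.
move=> /esym/orP[]/eqP/vtx_inj h1 /esym/orP[]/eqP/vtx_inj h2; lia.
Qed.

Lemma mem_pedges x y : [set x; y] \in pedges s p ->
  exists2 n, (n < size p)%N &
    x = vtx s p n /\ y = vtx s p n.+1 \/ x = vtx s p n.+1 /\ y = vtx s p n.
Proof.
case/imsetP=> n _ /setP E; exists n => //.
have := E (vtx s p n); have := E (vtx s p n.+1).
have ne : vtx s p n != vtx s p n.+1.
  by apply/eqP => /vtx_inj; have := ltn_ord n; lia.
rewrite !inE !eqxx orbT /=.
by move: ne => /[swap] /orP[]/eqP-> /[swap] /orP[]/eqP->; rewrite ?eqxx; auto.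
Qed.

Lemma pedge_in n : (n < size p)%N -> pedge s p n \in pedges s p.
Proof. by move=> hn; apply/imsetP; exists (Ordinal hn). Qed.

(** Inserted between the prefix up to [a] and the suffix from [b], a cheaper walk would give an
    [s]-[t] walk shorter than [p]. *)
Lemma pos_le_walk a b c : (a <= b <= size p)%N ->
  walk G (vtx s p a) (vtx s p b) c -> pos b - pos a <= c.
Proof.
have toG u v e : walk (del G set0) u v e -> walk G u v e.
  by apply: sub_walk => // x y /andP[].
have W i j : (i <= j <= size p)%N ->
    walk G (vtx s p i) (vtx s p j) (pos j - pos i).
  by move=> ij; apply/toG/pathwalk => // n; rewrite inE.
move=> /andP[ab bp] wc.
have [_ E] := p_shortest.
have w1 := walk_cat (W 0%N a _) (walk_cat wc (W b (size p) _)).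
have := dist_le G_ge0 (w1 _ _); rewrite vtx_last -E lee_fin.
have -> : plen G s p = pos (size p) by rewrite /pos take_size.
rewrite pos0 subr0 (leq_trans ab bp) bp leqnn => /(_ isT isT).
lra.
Qed.

Lemma aux_adj_inl (d : 'I_(size p)) x : aux_adj s (inl d) x <->
  exists2 a, (a <= d)%N & x = vtx s p a.
Proof.
have dp := ltn_ord d.
have sz : size (take d.+1 (s :: p)) = d.+1 by rewrite size_takel //= ltnW.
rewrite /aux_adj; split=> [/(nthP s)[a]|[a ad ->]].
  by rewrite sz ltnS => ad <-; exists a; rewrite // /vtx nth_take.
by rewrite /vtx -(@nth_take d.+1) // mem_nth // sz.
Qed.

Lemma aux_adj_inr (d : 'I_(size p)) x : aux_adj s (inr d) x <->
  exists2 a, (d < a <= size p)%N & x = vtx s p a.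
Proof.
have dp := ltn_ord d.
have sz : size (drop d.+1 (s :: p)) = (size p - d)%N by rewrite size_drop.
rewrite /aux_adj; split=> [/(nthP s)[a]|[a ad ->]].
  rewrite sz => ad <-; exists (d.+1 + a)%N; first lia.
  by rewrite /vtx nth_drop.
have -> : vtx s p a = nth s (drop d.+1 (s :: p)) (a - d.+1).
  by rewrite nth_drop /vtx subnKC //; lia.
by rewrite mem_nth // sz; lia.
Qed.

Lemma aux_wt_inl (d : 'I_(size p)) a : (a <= size p)%N ->
  aux_wt G s (inl d) (vtx s p a) = pos a + total_weight G.
Proof. by move=> ha; rewrite /aux_wt index_vtx. Qed.

Lemma aux_wt_inr (d : 'I_(size p)) a : (a <= size p)%N ->
  aux_wt G s (inr d) (vtx s p a) = pos (size p) - pos a + total_weight G.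
Proof.
move=> ha; rewrite /aux_wt index_vtx // -last_take_vtx //; congr (_ + _).
have -> : pos (size p) = plen G s (take a p ++ drop a p).
  by rewrite /pos take_size cat_take_drop.
by rewrite plen_cat addrC addKr.
Qed.

Lemma pos_mono a b : (a <= b <= size p)%N -> pos a <= pos b.
Proof.
move=> ab; rewrite -subr_ge0; apply: (walk_ge0 (nonneg_del (F := set0) G_ge0)).
by apply: pathwalk => // n; rewrite inE.
Qed.

(** [aux_wt] is N plus the nonnegative length of a subpath. This makes every visit to a further new
    vertex expensive. *)
Lemma total_weight_le_aux_wt (c : 'I_(size p) + 'I_(size p)) x :
  aux_adj s c x -> total_weight G <= aux_wt G s c x.
Proof.
case: c => d; [case/aux_adj_inl|case/aux_adj_inr] => a ha ->.
  have hd : (a <= size p)%N := leq_trans ha (ltnW (ltn_ord d)).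
  by rewrite aux_wt_inl // -{1}[leLHS]add0r lerD2r -pos0 pos_mono.
case/andP: ha => _ ha; rewrite aux_wt_inr // -{1}[leLHS]add0r lerD2r.
by rewrite subr_ge0 pos_mono // ha leqnn.
Qed.

Lemma total_weight_ge0 : 0 <= total_weight G.
Proof.
by apply: sumr_ge0 => x _; apply: sumr_ge0 => y /andP[/G_ge0].
Qed.

(** * Walks in the auxiliary graphs *)

Definition old_graph (K F : {set {set V}}) : wgraph R V :=
  del G ((pedges s p :\: K) :|: F).

(** Common form of all graphs in the four values: [K] collects the restored path edges and [F] the
    deleted edges. The restriction to the vertices of G is [old_graph K F]. *)
Definition aux_graph (K F : {set {set V}}) :=
  del (Hplus G s p K) [set old_edge p e | e in F].

Lemma aux_graph_old K F x y :
  adj (aux_graph K F) (inl x) (inl y) = adj (old_graph K F) x y.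
Proof.
rewrite /aux_graph /old_graph /= -andbA; congr (_ && _).
rewrite in_setU negb_or; congr (_ && _).
have -> : [set inl x; inl y] = old_edge p [set x; y].
  by rewrite /old_edge imsetU1 imset_set1.
by rewrite mem_imset //; apply: imset_inj => ? ? [].
Qed.

Lemma aux_graph_new K F c x :
  adj (aux_graph K F) (inr c) (inl x) = aux_adj s c x.
Proof.
rewrite /aux_graph /= andb_idr // => _; apply/imsetP => -[e _ /setP].
move=> /(_ (inr c)); rewrite !inE eqxx /= => /esym/imsetP[].
by [].
Qed.

Lemma nonneg_aux K F : nonneg_weights (aux_graph K F).
Proof.
apply: nonneg_del => -[x|c] [y|c'] //=; first by case/andP=> /G_ge0.
all: by move/total_weight_le_aux_wt; apply: le_trans total_weight_ge0.
Qed.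

Lemma old_walk K F x y c : walk (old_graph K F) x y c ->
  walk (aux_graph K F) (inl x) (inl y) c.
Proof.
case=> q [+ <-] <-; elim: q x => [|z q IH] x.
  by rewrite plen_nil => _; apply: walk_refl.
rewrite path_cons; case/andP; rewrite -aux_graph_old plen_cons => xz /IH.
exact: walk_cat (walk_edge xz).
Qed.

Lemma aux_walk_start K F a x y c :
    aux_adj s a x -> walk (old_graph K F) x y c ->
  walk (aux_graph K F) (inr a) (inl y) (aux_wt G s a x + c).
Proof.
rewrite -(aux_graph_new K F) => /walk_edge + /old_walk.
exact: walk_cat.
Qed.

(** New vertices are pairwise non-adjacent, so visiting one takes an edge in and an edge out, each
    of weight at least N; without such a visit the walk stays on vertices of G. *)
Lemma aux_walk_mid K F x y c : walk (aux_graph K F) (inl x) (inl y) c ->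
  total_weight G *+ 2 <= c \/ walk (old_graph K F) x y c.
Proof.
case=> q [+ +] <-.
have [n] := ubnP (size q); elim: n q x => // n IH [|[z|a] q] x szq.
- by move=> _ [<-]; rewrite plen_nil; right; apply: walk_refl.
- rewrite path_cons aux_graph_old plen_cons => /andP[xz zq] lq.
  have [Hn|Hw] := IH q z szq zq lq; [left|right].
    by rewrite -[leLHS]add0r lerD //; case/andP: xz => /G_ge0.
  exact: (walk_cat (walk_edge xz)).
- case: q szq => [|[z|b] q] szq; rewrite ?path_cons.
  + by [].
  + case/and3P=> xa az zq _; left; rewrite !plen_cons.
    have h0 : 0 <= plen (aux_graph K F) (inl z) q.
      by apply: plen_ge0 zq; apply: nonneg_aux.
    move: xa az; rewrite adj_sym !aux_graph_new.
    move=> /total_weight_le_aux_wt h1 /total_weight_le_aux_wt h2.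
    rewrite mulr2n addrA -[leLHS]addr0 lerD // lerD //.
  + by case/and3P.
Qed.

(** The first edge contributes at least N, and what follows starts at a vertex of G, so
    [aux_walk_mid] applies to it. *)
Lemma aux_walk_from K F a y c : walk (aux_graph K F) (inr a) (inl y) c ->
  total_weight G *+ 3 <= c \/
  exists x e, [/\ aux_adj s a x, walk (old_graph K F) x y e &
                  c = aux_wt G s a x + e].
Proof.
case=> -[|[x|b] q] [] //.
move=> /andP[+ pq] lq <-; rewrite aux_graph_new plen_cons => ax.
have [h|h] := aux_walk_mid (ex_intro2 _ _ q (conj pq lq) erefl).
  by left; rewrite mulrS lerD // total_weight_le_aux_wt.
by right; exists x, (plen (aux_graph K F) (inl x) q).
Qed.

(** As [a != b], there is a last edge, and it enters [b] from a vertex of G; removing it leaves a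
    walk for [aux_walk_from]. *)
Lemma aux_walk_between K F a b c : a != b ->
    walk (aux_graph K F) (inr a) (inr b) c ->
  total_weight G *+ 4 <= c \/
  exists x y e, [/\ aux_adj s a x, aux_adj s b y, walk (old_graph K F) x y e &
                  c = aux_wt G s a x + e + aux_wt G s b y].
Proof.
move=> /eqP ab [q []]; case/lastP: q => [|q z]; first by move=> _ [].
rewrite last_rcons => + E <-; rewrite {z}E rcons_path => /andP[pq].
case E : (last (inr a) q) => [y|d] //.
rewrite adj_sym aux_graph_new => by_.
rewrite -cats1 plen_cat plen_cons plen_nil addr0 E.
have [h|[x [e [ax w ->]]]] := aux_walk_from (ex_intro2 _ _ q (conj pq E) erefl).
  left; rewrite mulrSr lerD // /plen.
  exact: total_weight_le_aux_wt.
by right; exists x, y, e.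
Qed.

End PathPositions.

(** * Dyadic positions and splitting of sequences *)

Lemma mposE k i j : (i <= k)%N -> (j <= 2 ^ i)%N ->
  mpos k i j = (j * 2 ^ (k - i))%N.
Proof.
elim: i j => [|i IH] j ik ji.
  by case: j ji => [|[|]] // _; rewrite subn0 mul1n.
(* A block of the previous level consists of two blocks of this one; odd indices are the
   midpoints. *)
have E : (2 ^ (k - i) = 2 * 2 ^ (k - i.+1))%N.
  by rewrite -expnS; congr expn; lia.
have {}IH h : (h <= 2 ^ i)%N -> mpos k i h = (h * 2 ^ (k - i))%N.
  by apply: IH; apply: ltnW.
rewrite /=; move: (2 ^ (k - i.+1))%N E => L E.
have [h jh] : exists h, j = (odd j + h.*2)%N.
  by exists j./2; rewrite odd_double_half.
rewrite expnS in ji; case: ifP => oj; rewrite oj /= in jh.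
  by rewrite jh /= doubleK IH ?E; lia.
by rewrite jh add0n doubleK IH ?E; lia.
Qed.

Lemma first_split (T : Type) (P : pred T) q : has P q ->
  exists q1 y q2, [/\ q = q1 ++ y :: q2, P y & all (predC P) q1].
Proof.
elim: q => //= x q IH; have [Px _|NPx /IH] := boolP (P x).
  by exists [::], x, q.
by move=> [q1 [y [q2 [-> Py Pq]]]]; exists (x :: q1), y, q2; rewrite /= NPx.
Qed.

Lemma last_split (T : Type) (P : pred T) u q : P u ->
  exists q1 q2, [/\ q = q1 ++ q2, P (last u q1) & all (predC P) q2].
Proof.
move=> Pu; elim/last_ind: q => [|q x [q1 [q2 [-> Pl Pq]]]].
  by exists [::], [::].
have [Px|NPx] := boolP (P x).
  by exists (rcons (q1 ++ q2) x), [::]; rewrite cats0 last_rcons.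
by exists q1, (rcons q2 x); rewrite rcons_cat all_rcons /= NPx.
Qed.

(** Every edge starts in [x] or [q] and ends in [q] or [y], so starts and ends may satisfy different
    conditions: [x] is exempt from [Q] and [y] from [P]. *)
Lemma path_sub_rcons (T : Type) (P Q : pred T) (e e' : rel T) x q y :
    (forall a b, P a -> Q b -> e a b -> e' a b) ->
    P x -> all P q -> all Q q -> Q y ->
  path e x (rcons q y) -> path e' x (rcons q y).
Proof.
move=> sub; elim: q x => [|z q IH] x /= Px.
  by rewrite !andbT => _ _ /(sub _ _ Px).
move=> /andP[Pz Pq] /andP[Qz Qq] Qy /andP[xz zq].
by rewrite (sub _ _ Px Qz xz) IH.
Qed.

(** * Replacement paths *)

Section Detour.
Context {R : realDomainType} {V : finType} (G : wgraph R V) (s t : V)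
  (p : seq V).
Hypothesis G_ge0 : nonneg_weights G.
Hypothesis p_shortest : shortest_path G s t p.
Variables (n1 n2 : 'I_(size p)) (d3 : {set V}).
Hypothesis n12 : (n1 < n2)%N.
Hypothesis d3_off : d3 \notin pedges s p.

Local Notation d1 := (pedge s p n1).
Local Notation d2 := (pedge s p n2).
Local Notation GF := (del G [set d1; d2; d3]).
(** Only edges that survive in each of the three auxiliary graphs. *)
Local Notation off := (del G (pedges s p :|: [set d3])).
Local Notation pos := (pos G s p).
Local Notation N := (total_weight G).

Lemma pedge_kept n : (n < size p)%N -> n != n1 -> n != n2 ->
  pedge s p n \notin [set d1; d2; d3].
Proof.
move=> hn nn1 nn2; rewrite !inE -orbA; apply/or3P; case=> /eqP.
- by move/(pedge_inj p_shortest hn (ltn_ord n1))/eqP; apply/negP.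
- by move/(pedge_inj p_shortest hn (ltn_ord n2))/eqP; apply/negP.
- by move=> E; move: d3_off; rewrite -E pedge_in.
Qed.

(** The edge from [d1^-] to [x] stands for the subpath from [s] to [x], whose edges all precede [d1]
    and so remain in [GF]. *)
Lemma prefix_walk x : aux_adj s (inl n1) x ->
  walk GF s x (aux_wt G s (inl n1) x - N).
Proof.
case/aux_adj_inl => a an1 ->.
have ha : (a <= size p)%N := leq_trans an1 (ltnW (ltn_ord n1)).
rewrite (aux_wt_inl p_shortest) // addrK.
have -> : pos a = pos a - pos 0%N by rewrite pos0 subr0.
apply: (pathwalk p_shortest (a := 0%N)) => // n /andP[_ na].
by apply: pedge_kept; lia.
Qed.

Lemma suffix_walk y : aux_adj s (inr n2) y ->
  walk GF y t (aux_wt G s (inr n2) y - N).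
Proof.
case/aux_adj_inr => a /andP[an2 ha] ->.
rewrite (aux_wt_inr p_shortest) // addrK -(vtx_last p_shortest).
apply: (pathwalk p_shortest) => [|n /andP[na hn]]; first by rewrite ha leqnn.
by apply: pedge_kept; lia.
Qed.

(** The inclusion expresses that [d1], [d2], [d3] are all absent from the auxiliary graph. *)
Lemma walk_to_GF (K F : {set {set V}}) x y c :
    [set d1; d2; d3] \subset (pedges s p :\: K) :|: F ->
  walk (old_graph G s p K F) x y c -> walk GF x y c.
Proof.
move=> /subsetP sub; apply: sub_walk => // u v /andP[uv h]; rewrite /= uv.
by apply: contra h; apply: sub.
Qed.

Lemma GF_ge0 : nonneg_weights GF.
Proof. exact: nonneg_del. Qed.

(** * No value lies below the replacement distance *)

Section LowerBounds.
Hypothesis connected : (dist GF s t < +oo)%E.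

(** A path attaining the distance in [GF] is a simple path of G, hence of length at most N. *)
Lemma GF_dist_fin : exists d, [/\ dist GF s t = d%:E, d <= N &
  forall c, walk GF s t c -> d <= c].
Proof.
have H c : walk GF s t c -> (dist GF s t <= c%:E)%E := dist_le GF_ge0.
move: connected H; case: distP => // q sq _ H; exists (plen GF s q).
split=> //.
apply: (simple_path_le_total G_ge0 (v := t)).
move: sq; rewrite /simple_path => /and3P[pq -> ->]; rewrite !andbT.
by apply: sub_path pq => x y /andP[].
Qed.

(** A walk through further new vertices costs at least 4N, which leaves 2N after the subtraction.
    Otherwise the two end edges are traded for a prefix and a suffix of the path, saving exactly
    2N. *)
Lemma dist_le_between (K F : {set {set V}}) :
    [set d1; d2; d3] \subset (pedges s p :\: K) :|: F ->
  (dist GF s t <= dist (aux_graph G s p K F) (dminus n1) (dplus n2)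
                  - (N *+ 2)%:E)%E.
Proof.
move=> sub; have [d [-> dN dw]] := GF_dist_fin.
rewrite leeBrDr //; apply: le_dist => c.
case/(aux_walk_between G_ge0 p_shortest) => // [h|[x [y [e [ax ay w ->]]]]].
  rewrite -EFinD lee_fin; move: h dN (total_weight_ge0 G_ge0).
  by move: N => M; clear sub; lra.
move: (dw _ (walk_cat (walk_cat (prefix_walk ax) (walk_to_GF sub w))
                       (suffix_walk ay))).
rewrite -EFinD lee_fin.
by move: N (aux_wt _ _ _ x) (aux_wt _ _ _ y) => M a b; clear sub; lra.
Qed.

Lemma dist_le_via (K F K' F' : {set {set V}}) x :
    [set d1; d2; d3] \subset (pedges s p :\: K) :|: F ->
    [set d1; d2; d3] \subset (pedges s p :\: K') :|: F' ->
  (dist GF s t <= dist (aux_graph G s p K F) (dminus n1) (old p x)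
                  + dist (aux_graph G s p K' F') (old p x) (dplus n2)
                  - (N *+ 2)%:E)%E.
Proof.
move=> sub sub'; have [d [-> dN dw]] := GF_dist_fin.
have N0 := total_weight_ge0 G_ge0.
rewrite leeBrDr //.
case: distP => [|q1 /and3P[pq1 /eqP lq1 _]].
  by case: distP => *; apply: leey.
case: distP => [|q2 /and3P[pq2 /eqP lq2 _]]; first exact: leey.
rewrite -!EFinD lee_fin.
have w1 : walk (aux_graph G s p K F) (dminus n1) (old p x)
  (plen (aux_graph G s p K F) (dminus n1) q1) by exists q1.
have : walk (aux_graph G s p K' F') (old p x) (dplus n2)
  (plen (aux_graph G s p K' F') (old p x) q2) by exists q2.
move: (plen _ _ q1) (plen _ _ q2) w1 {pq1 pq2 lq1 lq2} => c1 c2 w1 /walk_sym w2.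
have [h1|[y [e1 [ay wy ->]]]] := aux_walk_from G_ge0 p_shortest w1;
have [h2|[z [e2 [az wz ->]]]] := aux_walk_from G_ge0 p_shortest w2.
- by move: h1 h2 dN N0; move: N => M; clear sub sub'; lra.
- move: (total_weight_le_aux_wt G_ge0 p_shortest az).
  move: (walk_ge0 GF_ge0 (walk_to_GF sub' wz)) h1 dN N0.
  by move: N (aux_wt _ _ _ _) => M a; clear sub sub'; lra.
- move: (total_weight_le_aux_wt G_ge0 p_shortest ay).
  move: (walk_ge0 GF_ge0 (walk_to_GF sub wy)) h2 dN N0.
  by move: N (aux_wt _ _ _ _) => M a; clear sub sub'; lra.
move: (dw _ (walk_cat (walk_cat (prefix_walk ay) (walk_to_GF sub wy))
   (walk_cat (walk_sym (walk_to_GF sub' wz)) (suffix_walk az)))).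
by move: N (aux_wt _ _ _ y) (aux_wt _ _ _ z) => M a b; clear sub sub'; lra.
Qed.

End LowerBounds.

(** * Decomposition of a walk along the three pieces of the path *)

Definition idx (x : V) : nat := index x (s :: p).
Arguments idx : simpl never.

Lemma idx_vtx n : (n <= size p)%N -> idx (vtx s p n) = n.
Proof. exact: index_vtx p_shortest _. Qed.

(** The prefix, middle and suffix pieces. A vertex off the path has index [(size p).+1]: the bounds
    [n1] and [n2] exclude it from [A] and [B], while [C] needs the explicit bound [size p]. *)
Let A := [pred x | (idx x <= n1)%N].
Let B := [pred x | (n1 < idx x <= n2)%N].
Let C := [pred x | (n2 < idx x <= size p)%N].

Lemma before_disjoint x : A x -> ~~ B x /\ ~~ C x.
Proof. by move=> /=; lia. Qed.

Lemma between_disjoint x : B x -> ~~ A x /\ ~~ C x.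
Proof. by move=> /=; lia. Qed.

Lemma after_disjoint x : C x -> ~~ A x /\ ~~ B x.
Proof. by move=> /= h; have := n12; lia. Qed.

Lemma before_le x : A x -> (idx x <= size p)%N.
Proof. by move=> /= h; have := ltn_ord n1; lia. Qed.

Lemma between_le x : B x -> (idx x <= size p)%N.
Proof. by move=> /= h; have := ltn_ord n2; lia. Qed.

Lemma vtx_idx x : (idx x <= size p)%N -> x = vtx s p (idx x).
Proof. by move=> h; rewrite /vtx nth_index // -index_mem ltnS. Qed.

Lemma pos_idx_le_walk x y c : (idx x <= idx y <= size p)%N ->
  walk G x y c -> pos (idx y) - pos (idx x) <= c.
Proof.
move=> /andP[xy yp]; rewrite {1}(vtx_idx yp) {1}(vtx_idx (leq_trans xy yp)).
by apply: (pos_le_walk G_ge0 p_shortest); rewrite xy.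
Qed.

Lemma idx_s : idx s = 0%N.
Proof. by rewrite /idx /= eqxx. Qed.

Lemma idx_t : idx t = size p.
Proof. by rewrite -(vtx_last p_shortest) idx_vtx. Qed.

(** A path edge other than [d1] and [d2] has both ends in the same piece. *)
Lemma GF_edge_off x y : adj GF x y -> ~~ (A x && A y) -> ~~ (B x && B y) ->
  ~~ (C x && C y) -> adj off x y.
Proof.
case/andP=> xy; rewrite !inE -!orbA !negb_or => /and3P[ed1 ed2 ed3] hA hB hC.
rewrite /= xy !inE (negbTE ed3) orbF.
apply/negP=> /(mem_pedges p_shortest)[n np D].
have nn1 : n <> n1.
  by move=> E; case: D => -[Ex Ey]; move/negP: ed1; apply; apply/eqP;
     rewrite Ex Ey E // setUC.
have nn2 : n <> n2.
  by move=> E; case: D => -[Ex Ey]; move/negP: ed2; apply; apply/eqP;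
     rewrite Ex Ey E // setUC.
have {D} : idx x = n /\ idx y = n.+1 \/ idx x = n.+1 /\ idx y = n.
  by case: D => -[-> ->]; rewrite !idx_vtx //; auto; lia.
have := ltn_ord n1; have := ltn_ord n2.
by move: hA hB hC => /= ????? [[? ?]|[? ?]]; lia.
Qed.

Lemma off_walk (P Q : pred V) x q y :
    (forall u v, P u -> Q v ->
       [/\ ~~ (A u && A v), ~~ (B u && B v) & ~~ (C u && C v)]) ->
    P x -> all P q -> all Q q -> Q y -> path (adj GF) x (rcons q y) ->
  walk off x y (plen G x (rcons q y)).
Proof.
move=> sub Px Pq Qq Qy pq.
exists (rcons q y); rewrite ?last_rcons //; split=> //.
apply: path_sub_rcons Px Pq Qq Qy pq => u v Pu Qv uv.
by have [] := sub _ _ Pu Qv; apply: GF_edge_off.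
Qed.

(* [vtx a] is the last vertex of the walk before [d1], [vtx b] and [vtx b'] are
   the first and the last vertex between [d1] and [d2] visited afterwards, and
   [vtx c'] is the first vertex behind [d2] visited after [vtx a]. *)
Lemma detour c : walk GF s t c ->
  exists a c' e, [/\ (a <= n1)%N, (n2 < c' <= size p)%N,
    pos a + e + (pos (size p) - pos c') <= c &
    walk off (vtx s p a) (vtx s p c') e \/
    exists b b' e1 e2, [/\ (n1 < b <= n2)%N, (n1 < b' <= n2)%N,
      walk off (vtx s p a) (vtx s p b) e1,
      walk off (vtx s p b') (vtx s p c') e2 &
      e = e1 + `|pos b - pos b'| + e2]].
Proof.
case=> q [pq lq] <-.
have As : A s by rewrite /= idx_s.
have Ct : C t.
  by rewrite /= idx_t ltn_ord leqnn.
have [q1 [q2 [Eq Ax nA]]] := last_split q As.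
move: pq lq; rewrite {q}Eq cat_path last_cat plen_cat.
set x := last s q1 in Ax *.
move=> /andP[pq1 pq2] lq2.
have hC : has C q2.
  rewrite -lq2 in Ct; case: q2 lq2 Ct {nA pq2} => [|z q2] _ Ct.
    by have [_ /negP] := before_disjoint Ax.
  by apply/hasP; exists (last x (z :: q2)); rewrite ?mem_last //= mem_last.
have [q3 [y [q4 [Eq Cy nC]]]] := first_split hC.
move: pq2 lq2 nA; rewrite {q2 hC}Eq -cat_rcons cat_path last_cat plen_cat.
rewrite last_rcons all_cat all_rcons.
move=> /andP[pq3 pq4] lq4 /andP[/andP[nAy nAq3] _].
have W0 : walk G s x (plen G s q1).
  by exists q1 => //; split=> //; apply: sub_path pq1 => ? ? /andP[].
have W4 : walk G y t (plen G y q4).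
  by exists q4 => //; split=> //; apply: sub_path pq4 => ? ? /andP[].
have hx := before_le Ax.
have hy : (idx y <= size p)%N by case/andP: Cy.
have le1 : pos (idx x) <= plen G s q1.
  by have := @pos_idx_le_walk s x _ _ W0; rewrite idx_s pos0 subr0; apply.
have le4 : pos (size p) - pos (idx y) <= plen G y q4.
  by rewrite -idx_t; apply: pos_idx_le_walk W4; rewrite idx_t hy leqnn.
have toG u v e : walk GF u v e -> walk G u v e.
  by apply: sub_walk => // ? ? /andP[].
have conc e : e <= plen G x (rcons q3 y) ->
    pos (idx x) + e + (pos (size p) - pos (idx y)) <=
    plen GF s q1 + (plen GF x (rcons q3 y) + plen GF y q4).
  by move=> le; rewrite -addrA; apply: lerD le1 (lerD le le4).
exists (idx x), (idx y).
have [hB|nB] := boolP (has B q3); last first.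
  exists (plen G x (rcons q3 y)); split=> //; first exact: conc.
  left; rewrite -!vtx_idx //.
  have [nBx nCx] := before_disjoint Ax.
  (* Edges start in [x] or [q3], outside [B] and [C], and end in [q3] or [y], outside [A]; hence
     none stays within one piece. *)
  apply: (@off_walk (predI (predC B) (predC C)) (predC A)) => //.
  - by move=> u v /andP[? ?] ?; split; apply/nandP; [right|left|left].
  - by apply/andP.
  - by rewrite all_predI nC andbT all_predC.
have [q5 [w [q6 [Eq Bw nB5]]]] := first_split hB.
have [q7 [q8 [Eq6 Bw' nB8]]] := last_split q6 Bw.
set w' := last w q7 in Bw'.
have hw := between_le Bw.
have hw' := between_le Bw'.
have Eq3 : rcons q3 y = rcons q5 w ++ q7 ++ rcons q8 y.
  by rewrite Eq Eq6 cat_rcons rcons_cat rcons_cons rcons_cat.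
rewrite Eq Eq6 -cat_cons !all_cat in nAq3 nC.
have [/and3P[nA5 _ nA8] /and3P[nC5 _ nC8]] := (nAq3, nC).
have [p5 p7 p8] : [/\ path (adj GF) x (rcons q5 w), path (adj GF) w q7 &
    path (adj GF) w' (rcons q8 y)].
  by move: pq3; rewrite Eq3 !cat_path last_rcons => /and3P.
have W7 : walk G w w' (plen G w q7) by apply: toG; exists q7.
have le7 : `|pos (idx w) - pos (idx w')| <= plen G w q7.
  (* The walk may leave [B] closer to [s] than it entered; then its reversal is compared with the
     subpath. *)
  have [le|/ltnW le] := leqP (idx w) (idx w').
    rewrite distrC ger0_norm; last first.
      by rewrite subr_ge0 (pos_mono G_ge0 p_shortest) // le.
    by apply: pos_idx_le_walk W7; rewrite le.
  rewrite ger0_norm; last by rewrite subr_ge0 (pos_mono G_ge0 p_shortest) // le.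
  by apply: pos_idx_le_walk (walk_sym W7); rewrite le.
exists (plen G x (rcons q5 w) + `|pos (idx w) - pos (idx w')|
        + plen G w' (rcons q8 y)).
split=> //.
  apply: conc; rewrite Eq3 !plen_cat last_rcons -/w' -addrA.
  by rewrite lerD2l lerD2r.
right; exists (idx w), (idx w').
exists (plen G x (rcons q5 w)), (plen G w' (rcons q8 y)).
rewrite -!vtx_idx //; split=> //.
- apply: (@off_walk (predC B) (predI (predC A) (predC C))) => //.
  + by move=> u v ? /andP[? ?]; split; apply/nandP; [right|left|right].
  + by have [] := before_disjoint Ax.
  + by rewrite all_predI nA5.
  + exact/andP/between_disjoint.
- apply: (@off_walk (predI (predC A) (predC C)) (predC B)) => //.
  + by move=> u v /andP[? ?] ?; split; apply/nandP; [left|right|left].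
  + exact/andP/between_disjoint.
  + by rewrite all_predI nA8.
  + by have [] := after_disjoint Cy.
Qed.

(** * Detours realised in the auxiliary graphs, and the minimum formula *)

Lemma off_to_old (K F : {set {set V}}) x y e :
    F \subset pedges s p :|: [set d3] ->
  walk off x y e -> walk (old_graph G s p K F) x y e.
Proof.
move=> /subsetP FE; apply: sub_walk => // u v /andP[uv h]; rewrite /= uv.
apply: contra h; rewrite inE => /orP[|/FE //].
by rewrite !inE => /andP[_ ->].
Qed.

Lemma segment_walk (K F : {set {set V}}) lo hi b b' :
    (hi <= size p)%N -> (lo <= b <= hi)%N -> (lo <= b' <= hi)%N ->
    (forall n, (lo <= n < hi)%N ->
       (pedge s p n \in K) && (pedge s p n \notin F)) ->
  walk (old_graph G s p K F) (vtx s p b) (vtx s p b') `|pos b - pos b'|.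
Proof.
move=> hip; wlog le : b b' / (b <= b')%N => [W hb hb' H|hb hb' H].
  have [/W|/ltnW/W] := leqP b b'; first exact.
  by rewrite distrC => {}W; apply: walk_sym; apply: W.
rewrite distrC ger0_norm; last first.
  by rewrite subr_ge0 (pos_mono G_ge0 p_shortest) //; lia.
apply: (pathwalk p_shortest) => [|n bn]; first by lia.
have /andP[nK nF] : (pedge s p n \in K) && (pedge s p n \notin F).
  by apply: H; lia.
by rewrite !inE nK.
Qed.

Lemma dist_minus_le (K F : {set {set V}}) a x e : (a <= n1)%N ->
    walk (old_graph G s p K F) (vtx s p a) x e ->
  (dist (aux_graph G s p K F) (dminus n1) (old p x) <= (pos a + N + e)%:E)%E.
Proof.
move=> an1 w; rewrite -(aux_wt_inl p_shortest n1); last first.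
  exact: leq_trans an1 (ltnW (ltn_ord n1)).
apply: dist_le; first exact: nonneg_aux p_shortest _ _.
apply: aux_walk_start w.
by apply/aux_adj_inl; exists a.
Qed.

Lemma dist_plus_le (K F : {set {set V}}) c' x e : (n2 < c' <= size p)%N ->
    walk (old_graph G s p K F) x (vtx s p c') e ->
  (dist (aux_graph G s p K F) (old p x) (dplus n2) <=
   (pos (size p) - pos c' + N + e)%:E)%E.
Proof.
move=> nc w; rewrite -(aux_wt_inr p_shortest n2); last by case/andP: nc.
apply: dist_le; first exact: nonneg_aux p_shortest _ _.
apply: walk_sym;
apply: aux_walk_start (walk_sym w).
by apply/aux_adj_inr; exists c'.
Qed.

Lemma dist_between_le (K F : {set {set V}}) a c' e :
    (a <= n1)%N -> (n2 < c' <= size p)%N ->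
    walk (old_graph G s p K F) (vtx s p a) (vtx s p c') e ->
  (dist (aux_graph G s p K F) (dminus n1) (dplus n2) - (N *+ 2)%:E <=
   (pos a + e + (pos (size p) - pos c'))%:E)%E.
Proof.
move=> an1 nc w.
have an : aux_adj s (inl n1) (vtx s p a) by apply/aux_adj_inl; exists a.
have cn : adj (aux_graph G s p K F) (inr (inr n2)) (inl (vtx s p c')).
  by rewrite aux_graph_new; apply/aux_adj_inr; exists c'.
rewrite leeBlDr // -EFinD.
have -> : pos a + e + (pos (size p) - pos c') + N *+ 2 =
    aux_wt G s (inl n1) (vtx s p a) + e + aux_wt G s (inr n2) (vtx s p c').
  rewrite (aux_wt_inl p_shortest) ?(aux_wt_inr p_shortest).
  - by ring.
  - by case/andP: nc.
  - exact: leq_trans an1 (ltnW (ltn_ord n1)).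
apply: dist_le; first exact: nonneg_aux p_shortest _ _.
exact: walk_cat (aux_walk_start an w) (walk_sym (walk_edge cn)).
Qed.

(** All that matters of the dyadic levels: [K0] has the path edges from [d1] to [m] but not [d2],
    and [K1] those from [m] to [d2] but not [d1]. *)
Lemma replacement_dist (m : nat) (K0 K1 : {set {set V}}) :
    (n1 < m <= n2)%N -> d2 \notin K0 -> d1 \notin K1 ->
    (forall n, (n1 < n < m)%N -> pedge s p n \in K0) ->
    (forall n, (m <= n < n2)%N -> pedge s p n \in K1) ->
    (dist GF s t < +oo)%E ->
  let H := aux_graph G s p set0 [set d3] in
  let H0 := aux_graph G s p K0 [set d1; d3] in
  let H1 := aux_graph G s p K1 [set d2; d3] in
  let v := old p (vtx s p m) in
  let N2 := (N *+ 2)%:E in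
  dist GF s t =
  Order.min (dist H (dminus n1) (dplus n2) - N2)%E
  (Order.min (dist H0 (dminus n1) (dplus n2) - N2)%E
  (Order.min (dist H1 (dminus n1) (dplus n2) - N2)%E
   (Order.min (dist H0 (dminus n1) v) (dist H1 (dminus n1) v)
    + Order.min (dist H0 v (dplus n2)) (dist H1 v (dplus n2)) - N2)%E)).
Proof.
move=> mb d2K d1K K0P K1P conn H H0 H1 v N2.
have mp : (m <= size p)%N by have := ltn_ord n2; lia.
(* The edge [d1] ends at position [n1.+1], where the middle piece begins. *)
have seg0 b b' : (n1 < b <= m)%N -> (n1 < b' <= m)%N ->
    walk (old_graph G s p K0 [set d1; d3]) (vtx s p b) (vtx s p b')
      `|pos b - pos b'|.
  move=> hb hb'; apply: (@segment_walk _ _ n1.+1 m) => // n nm.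
  have np : (n < size p)%N by lia.
  have := @pedge_kept n np; rewrite K0P //= !inE !negb_or.
  by case/(_ _ _)/andP => [||/andP[-> _] ->] //; apply/eqP; lia.
have seg1 b b' : (m <= b <= n2)%N -> (m <= b' <= n2)%N ->
    walk (old_graph G s p K1 [set d2; d3]) (vtx s p b) (vtx s p b')
      `|pos b - pos b'|.
  move=> hb hb'; apply: (@segment_walk _ _ m n2) => //; first exact: ltnW.
  move=> n nm.
  have np : (n < size p)%N by have := ltn_ord n2; lia.
  have := @pedge_kept n np; rewrite K1P //= !inE !negb_or.
  by case/(_ _ _)/andP => [||/andP[_ ->] ->] //; apply/eqP; lia.
have d1p := pedge_in s (ltn_ord n1); have d2p := pedge_in s (ltn_ord n2).
have sub : [set d1; d2; d3] \subset (pedges s p :\: set0) :|: [set d3].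
  by apply/subsetP=> e; rewrite !inE -orbA => /or3P[]/eqP->;
     rewrite ?d1p ?d2p ?eqxx ?orbT.
have sub0 : [set d1; d2; d3] \subset (pedges s p :\: K0) :|: [set d1; d3].
  by apply/subsetP=> e; rewrite !inE -orbA => /or3P[]/eqP->;
     rewrite ?d2p ?d2K ?eqxx ?orbT.
have sub1 : [set d1; d2; d3] \subset (pedges s p :\: K1) :|: [set d2; d3].
  by apply/subsetP=> e; rewrite !inE -orbA => /or3P[]/eqP->;
     rewrite ?d1p ?d1K ?eqxx ?orbT.
apply/le_anti/andP; split.
  rewrite !le_min !dist_le_between //=.
  (* The minima may be attained in different graphs, so all four pairs of legs are covered. *)
  by rewrite !minEle; case: ifP => _; case: ifP => _; apply: dist_le_via.
have F0 : [set d3] \subset pedges s p :|: [set d3] by rewrite subsetUr.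
have F1 : [set d1; d3] \subset pedges s p :|: [set d3].
  by rewrite subUset F0 andbT sub1set inE d1p.
have F2 : [set d2; d3] \subset pedges s p :|: [set d3].
  by rewrite subUset F0 andbT sub1set inE d2p.
apply: le_dist => c /detour [a [c' [e [an1 nc le_c]]]].
have fin z : (z <= (pos a + e + (pos (size p) - pos c'))%:E)%E -> (z <= c%:E)%E.
  by move/le_trans; apply; rewrite lee_fin.
rewrite !ge_min; case=> [w|[b [b' [e1 [e2 [hb hb' w1 w2 Ee]]]]]].
  by rewrite fin // dist_between_le //; apply: off_to_old w.
have mono x y : (x <= y <= n2)%N -> pos x <= pos y.
  move=> /andP[xy yn]; apply: (pos_mono G_ge0 p_shortest).
  by rewrite xy (leq_trans yn (ltnW (ltn_ord n2))).
(* Bounds value (4) when [m] lies between [b] and [b'], so that the subpath splits at [m] without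
   loss. *)
have via (X Y : \bar R) :
    `|pos b - pos m| + `|pos m - pos b'| = `|pos b - pos b'| ->
    (X <= (pos a + N + (e1 + `|pos b - pos m|))%:E)%E ->
    (Y <= (pos (size p) - pos c' + N + (`|pos m - pos b'| + e2))%:E)%E ->
    (X + Y - N2 <= c%:E)%E.
  move=> tri hX hY; apply: fin; rewrite /N2 leeBlDr // -EFinD.
  apply: le_trans (leeD hX hY) _; rewrite -EFinD lee_fin Ee -tri.
  by rewrite le_eqVlt; apply/orP; left; apply/eqP; ring.
have [/andP[n1b bn2] /andP[n1b' bn2']] := (hb, hb').
have /andP[n1m mn2] := mb.
(* Both on the [d1] side of [m] gives value (2), both on the [d2] side value (3), opposite sides
   value (4). *)
have [bm|/ltnW bm] := leqP b m; have [bm'|/ltnW bm'] := leqP b' m.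
- have w := walk_cat (off_to_old K0 F1 w1) (walk_cat
    (seg0 b b' (introT andP (conj n1b bm)) (introT andP (conj n1b' bm')))
    (off_to_old K0 F1 w2)).
  by rewrite addrA -Ee in w; rewrite (fin _ (dist_between_le an1 nc w)) ?orbT.
- rewrite [X in [|| _, _, _ | X]]via ?orbT // ?ge_min.
  + rewrite [`|pos b - pos m|]distrC [`|pos m - pos b'|]distrC.
    rewrite [`|pos b - pos b'|]distrC.
    rewrite !ger0_norm ?subr_ge0 ?mono ?bm ?bm' ?mn2 ?bn2' ?(leq_trans bm) //.
    by ring.
  + rewrite dist_minus_le //; apply: walk_cat (off_to_old K0 F1 w1) (seg0 _ _ _ _).
      by rewrite n1b.
    by rewrite n1m leqnn.
  + rewrite [X in _ || X]dist_plus_le ?orbT //.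
    apply: walk_cat (seg1 _ _ _ _) (off_to_old K1 F2 w2).
      by rewrite leqnn.
    by rewrite bm'.
(* Here [m] is crossed backwards, so the first leg lives in [H1] and the second in [H0]; this is why
   (4) takes a minimum for each leg. *)
- rewrite [X in [|| _, _, _ | X]]via ?orbT // ?ge_min.
  + rewrite !ger0_norm ?subr_ge0 ?mono ?bm ?bm' ?mn2 ?bn2 ?(leq_trans bm') //.
    by ring.
  + rewrite [X in _ || X]dist_minus_le ?orbT //.
    apply: walk_cat (off_to_old K1 F2 w1) (seg1 _ _ _ _).
      by rewrite bm.
    by rewrite leqnn.
  + rewrite dist_plus_le //; apply: walk_cat (seg0 _ _ _ _) (off_to_old K0 F1 w2).
      by rewrite n1m leqnn.
    by rewrite n1b'.
- have w := walk_cat (off_to_old K1 F2 w1) (walk_cat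
    (seg1 b b' (introT andP (conj bm bn2)) (introT andP (conj bm' bn2')))
    (off_to_old K1 F2 w2)).
  by rewrite addrA -Ee in w; rewrite (fin _ (dist_between_le an1 nc w)) ?orbT.
Qed.

End Detour.

(** * Dyadic blocks and the separating level *)

Lemma mem_Qedges (R : realDomainType) (V : finType) (G : wgraph R V) (s t : V)
    (p : seq V) (k i j n : nat) :
    shortest_path G s t p -> (i <= k)%N -> (j < 2 ^ i)%N -> (n < size p)%N ->
  (pedge s p n \in Qedges s p k i j) =
  (j * 2 ^ (k - i) <= n < j.+1 * 2 ^ (k - i))%N.
Proof.
move=> sp ik ji np; rewrite -!mposE //; last exact: ltnW.
apply/imsetP/idP => [[h hn /(pedge_inj sp np (ltn_ord h)) ->]|hn].
  by rewrite inE in hn.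
by exists (Ordinal np); rewrite // inE.
Qed.

(** Both numbers are the quotient of [n] by [L]. *)
Lemma same_block (L n a b : nat) :
  (a * L <= n < a.+1 * L)%N -> (b * L <= n < b.+1 * L)%N -> a = b.
Proof.
move=> /andP[al ar] /andP[bl br].
have L0 : (0 < L)%N by move: ar; case: L {al bl br} => //; rewrite muln0.
have le x y : (x * L < y.+1 * L)%N -> (x <= y)%N by rewrite ltn_pmul2r.
apply/anti_leq/andP.
by split; apply: le; [apply: leq_ltn_trans al br|apply: leq_ltn_trans bl ar].
Qed.

Theorem theorem27 (R : realDomainType) (V : finType) (G : wgraph R V)
    (G_ge0 : nonneg_weights G) (s t : V) (p : seq V) (k : nat)
    (p_shortest : shortest_path G s t p) (p_size : size p = (2 ^ k)%N)
    (l r : nat) (l_gt0 : (0 < l)%N) (l_le_r : (l <= r)%N)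
    (r_lt : (r < 2 ^ k)%N)
    (n1 n2 : 'I_(size p)) (n1E : n1 = l.-1 :> nat) (n2E : n2 = r :> nat)
    (i j : nat) (i_bounds : (1 <= i <= k)%N)
    (ij_sep : separated_at s p k (pedge s p n1) (pedge s p n2) i j)
    (i_min : forall i' j' : nat, (1 <= i' < i)%N ->
       ~~ separated_at s p k (pedge s p n1) (pedge s p n2) i' j')
    (a b : V) (ab_edge : adj G a b) (ab_off : [set a; b] \notin pedges s p) :
  let d1 := pedge s p n1 in
  let d2 := pedge s p n2 in
  let d3 := [set a; b] in
  let N2 := (total_weight G *+ 2)%:E in
  let H3 := del (Hgraph G s p) [set old_edge p d3] in
  let H013 := del (Hlevel G s p k i false)
                  [set old_edge p d1; old_edge p d3] in
  let H123 := del (Hlevel G s p k i true)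
                  [set old_edge p d2; old_edge p d3] in
  let m := old p (mvtx s p k i j) in
  let GF := del G [set d1; d2; d3] in
  let val1 := (dist H3 (dminus n1) (dplus n2) - N2)%E in
  let val2 := (dist H013 (dminus n1) (dplus n2) - N2)%E in
  let val3 := (dist H123 (dminus n1) (dplus n2) - N2)%E in
  let val4 := (Order.min (dist H013 (dminus n1) m) (dist H123 (dminus n1) m)
               + Order.min (dist H013 m (dplus n2)) (dist H123 m (dplus n2))
               - N2)%E in
  (dist GF s t < +oo)%E ->
  dist GF s t = Order.min val1 (Order.min val2 (Order.min val3 val4)).
Proof.
have [i0 ik] := andP i_bounds.
have np1 := ltn_ord n1; have np2 := ltn_ord n2.
have memQ i' j' n : (i' <= k)%N -> (j' < 2 ^ i')%N -> (n < size p)%N ->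
    (pedge s p n \in Qedges s p k i' j') =
    (j' * 2 ^ (k - i') <= n < j'.+1 * 2 ^ (k - i'))%N.
  by move=> ik' ji'; apply: mem_Qedges p_shortest ik' ji'.
have [/andP[j0 ji] d1Q d2Q] := and3P ij_sep.
have ji1 : (j.-1 < 2 ^ i)%N := leq_ltn_trans (leq_pred j) ji.
rewrite memQ // prednK // in d1Q.
rewrite memQ // in d2Q.
(* If [j] were even, the two blocks would lie in adjacent blocks of level
   [i.-1]. *)
have oj : odd j.
  have [//|ej] := boolP (odd j).
  have Ej : j = (j./2).*2 by rewrite -[LHS]odd_double_half (negbTE ej).
  (* Minimality speaks only of levels from 1 on; at level 1 the only possible index is 1, which is
     odd. *)
  have i1 : (1 < i)%N.
    rewrite ltn_neqAle i0 andbT; apply/eqP=> i1.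
    by move: ji j0 Ej; rewrite -i1 expn1; clear; lia.
  have E2 : (2 ^ i = 2 * 2 ^ i.-1)%N by rewrite -expnS prednK.
  have Ek : (2 ^ (k - i.-1) = 2 * 2 ^ (k - i))%N.
    by rewrite -expnS; congr expn; lia.
  have im : (1 <= i.-1 < i)%N by lia.
  have /negP[] := i_min i.-1 j./2 im.
  move: (memQ i.-1) d1Q d2Q ji; rewrite /separated_at E2 Ek.
  case: (j./2) Ej => [|h] ->; first by move: j0; case: (j).
  rewrite doubleS /=.
  move: (2 ^ (k - i))%N (2 ^ i.-1)%N => L I mQ d1Q d2Q hI.
  have [ik' hI'] : (i.-1 <= k)%N /\ (h.+1 < I)%N by split; lia.
  rewrite !mQ // ?(ltnW hI') //=.
  clear -d1Q d2Q hI'; lia.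
set L := (2 ^ (k - i))%N in d1Q d2Q.
(* A path edge lies in a single block, so the parity of that block decides membership. *)
have K_mem (c : bool) n j' : (n < size p)%N -> (j' < 2 ^ i)%N ->
    (j' * L <= n < j'.+1 * L)%N ->
    (pedge s p n \in \bigcup_(h < 2 ^ i | odd h == c) Qedges s p k i h)
    = (odd j' == c).
  move=> np ji' hn; apply/bigcupP/idP => [[h /eqP <-]|cj].
    rewrite memQ // => hn'; suff -> : j' = h by [].
    exact: same_block hn hn'.
  by exists (Ordinal ji'); rewrite //= memQ.
have mE : mpos k i j = (j * L)%N by rewrite mposE // ltnW.
have n12 : (n1 < n2)%N by rewrite n1E n2E prednK.
have [[/andP[n1l n1u] /andP[n2l n2u]]] := (d1Q, d2Q).
have oj1 : odd j.-1 = false by apply/negbTE; rewrite -oddS prednK.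
move=> d1 d2 d3 N2 H3 H013 H123 m GF val1 val2 val3 val4 conn.
have := @replacement_dist _ _ G s t p G_ge0 p_shortest n1 n2 d3 n12 ab_off
  (mpos k i j) (\bigcup_(h < 2 ^ i | odd h == false) Qedges s p k i h)
  (\bigcup_(h < 2 ^ i | odd h == true) Qedges s p k i h) _ _ _ _ _ conn.
rewrite /aux_graph !imsetU1 !imset_set1; apply; rewrite ?mE.
- by rewrite n1u n2l.
- by rewrite (K_mem false n2 j) // oj.
- by rewrite (K_mem true n1 j.-1 np1 ji1) ?oj1 // prednK // n1l.
(* Edges between [d1] and [m] share the block of [d1], whose index [j.-1] is even. *)
- move=> n /andP[n1n nj].
  have np : (n < size p)%N := ltn_trans (leq_trans nj n2l) np2.
  rewrite (K_mem false n j.-1 np ji1) ?oj1 // prednK // nj.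
  by rewrite (leq_trans n1l (ltnW n1n)).
- move=> n /andP[jn nn2].
  have np : (n < size p)%N := ltn_trans nn2 np2.
  by rewrite (K_mem true n j) ?jn ?(ltn_trans nn2) // oj.
Qed.
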